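(* Let $J:C[0,1]\rightrightarrows rca[0,1]$ be the normalized duality mapping of the real Banach space $C[0,1]$. Let $f\in C^+[0,1]$ with $\|f\|>0$, and let $f^{**}\in rca^*[0,1]$ be the functional induced by $f$. Then, for any $\mu\in J(f)$, $$c\mu\notin\widehat{D}^*J(f,\mu)(f^{**}),\quad\text{for any } c>0\text{ with } c\neq1,$$ where $(c\mu)(A):=c\,\mu(A)$ for any $A\in\Sigma$.
   Context: $C[0,1]$ is the Banach space of continuous real functions on $[0,1]$ with the maximum norm $\|\cdot\|$; its dual $C^*[0,1]=rca[0,1]$ is the space of regular countably additive real-valued measures on the Borel $\sigma$-field $\Sigma$ of $[0,1]$, with pairing $\langle\mu,f\rangle=\int_0^1 f(s)\,\mu(ds)$ and norm $\|\mu\|_*=v(\mu,[0,1])$, the total variation of $\mu$ (the dual norm). $rca^*[0,1]=C^{**}[0,1]$ is the dual of $rca[0,1]$, with pairing $\langle\cdot,\cdot\rangle_*$. $C^+[0,1]=\{f\in C[0,1]: f(s)\ge0\ \forall s\in[0,1]\}$. Each $f\in C^+[0,1]$ induces $f^{**}\in rca^*[0,1]$ by $\langle f^{**},\gamma\rangle_*=\langle\gamma,f\rangle$ for all $\gamma\in rca[0,1]$. The normalized duality mapping is $J(f)=\{\mu\in rca[0,1]:\langle\mu,f\rangle=\|f\|^2=\|\mu\|_*^2\}$. For $\mu\in J(f)$, the Mordukhovich derivative of $J$ at $(f,\mu)$ is defined, for $\Phi\in C^{**}[0,1]$, by $$\widehat{D}^*J(f,\mu)(\Phi)=\left\{\lambda\in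 rca[0,1]:\ \limsup_{(g,\gamma)\to(f,\mu),\ g\in C[0,1],\ \gamma\in J(g)}\frac{\langle\lambda,g-f\rangle-\langle\Phi,\gamma-\mu\rangle_*}{\|g-f\|+\|\gamma-\mu\|_*}\le0\right\},$$ with convergence in the norms and $(g,\gamma)\neq(f,\mu)$. *)

(* Defs.v *)
From HB Require Import structures.
From mathcomp Require Import all_boot all_order all_algebra.
From mathcomp Require Import all_classical all_reals all_analysis.
From mathcomp Require Import measurable_realfun.

Set Implicit Arguments.
Unset Strict Implicit.
Unset Printing Implicit Defensive.

Import Order.TTheory GRing.Theory Num.Theory.
Import numFieldNormedType.Exports.

Local Open Scope classical_set_scope.
Local Open Scope ring_scope.

(* [set_type] carries the topology induced by R. *)
Definition I01 (R : realType) : Type := set_type `[0 : R, 1 : R].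

Section I01.
Variable R : realType.

HB.instance Definition _ := PseudoMetric.on (I01 R).

Lemma I01_0_subproof : (0 : R) \in `[0 : R, 1 : R]%classic.
Proof. by rewrite inE/= bound_itvE ler01. Qed.

HB.instance Definition _ :=
  isPointed.Build (I01 R) (exist _ 0 I01_0_subproof : I01 R).

Lemma I01_clamp_subproof (x : R) :
  Num.max 0 (Num.min x 1) \in `[0 : R, 1 : R]%classic.
Proof.
by rewrite inE/= in_itv/= le_max lexx ge_max ler01 ge_min lexx orbT.
Qed.

Let clamp (x : R) : I01 R :=
  @exist R (fun y => y \in `[0 : R, 1 : R]%classic) _ (I01_clamp_subproof x).

Let clamp_continuous : continuous clamp.
Proof.
apply: continuous_comp_initial => x.
rewrite (_ : _ \o _ = (fun x : R => Num.max 0 (Num.min x 1)))//.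
apply: (@continuous_max R R (cst 0) (fun y => Num.min y 1)).
  exact: cst_continuous.
by apply: (@continuous_min R R id (cst 1)); [exact: cvg_id|exact: cst_continuous].
Qed.

Lemma I01_compact : compact [set: I01 R].
Proof.
rewrite (_ : setT = clamp @` `[0, 1]).
  apply: continuous_compact; last exact: segment_compact.
  exact: continuous_subspaceT.
apply/seteqP; split=> [[x x01] _|]//.
have x01' : x \in `[0 : R, 1] := set_mem x01.
exists x => //; apply: val_inj => /=.
by move: x01'; rewrite /= in_itv/= => /andP[x0 x1]; rewrite min_l// max_r.
Qed.

End I01.

Definition C01_pred (R : realType) : {pred I01 R -> R} :=
  mem [set f : I01 R -> R | continuous f].
Arguments C01_pred : clear implicits.

Record C01 (R : realType) := MkC01 {
  C01_fun :> I01 R -> R ;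
  C01_cts : C01_fun \in C01_pred R }.

Section C01.
Variable R : realType.

HB.instance Definition _ := [isSub for @C01_fun R].
HB.instance Definition _ := [Choice of C01 R by <:].

Let continuous_submod_closed :
  submod_closed (C01_pred R).
Proof.
rewrite /C01_pred; split=> [|a f g]; rewrite ?inE.
  by move=> x; exact: cst_continuous.
move=> cf cg x; apply: continuousD; last exact: cg.
by apply: (@continuousM R _ (cst a) f x); [exact: cst_continuous|exact: cf].
Qed.

HB.instance Definition _ := GRing.isSubmodClosed.Build R (I01 R -> R)
  (C01_pred R) continuous_submod_closed.
HB.instance Definition _ := [SubChoice_isSubLmodule of C01 R by <:].

Lemma C01_continuous (f : C01 R) : continuous f.
Proof. by have := C01_cts f; rewrite /C01_pred inE. Qed.

(* The supremum is a maximum because [0, 1] is compact. *)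
Definition maxnorm (f : C01 R) : R := sup [set `|f x| | x in [set: I01 R]].

Lemma maxnorm_has_sup (f : C01 R) : has_sup [set `|f x| | x in [set: I01 R]].
Proof.
split; first by exists `|f point|, point.
have cf : {within [set: I01 R], continuous f}.
  by apply: continuous_subspaceT; exact: C01_continuous.
have /compact_bounded[M [_ Mf]] := continuous_compact cf (@I01_compact R).
by exists (M + 1) => _ [x _ <-]; apply: (Mf (M + 1)); [rewrite ltrDl|exists x].
Qed.

Lemma maxnorm_ub (f : C01 R) (x : I01 R) : `|f x| <= maxnorm f.
Proof. by apply: ub_le_sup; [case: (maxnorm_has_sup f)|exists x]. Qed.

Lemma maxnorm_le (f : C01 R) (M : R) :
  (forall x, `|f x| <= M) -> maxnorm f <= M.
Proof.
move=> fM; apply: ge_sup; first by case: (maxnorm_has_sup f).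
by move=> _ [x _ <-].
Qed.

Let maxnormD (f g : C01 R) : maxnorm (f + g) <= maxnorm f + maxnorm g.
Proof.
apply: maxnorm_le => x.
by rewrite (le_trans (ler_normD _ _))// lerD// maxnorm_ub.
Qed.

Let maxnormZ (a : R) (f : C01 R) : maxnorm (a *: f) = `|a| * maxnorm f.
Proof.
have le b g : maxnorm (b *: g) <= `|b| * maxnorm g.
  by apply: maxnorm_le => x; rewrite [_ x]/(b * g x) normrM ler_wpM2l// maxnorm_ub.
apply/eqP; rewrite eq_le le/=; have [->|a0] := eqVneq a 0.
  by rewrite normr0 mul0r (le_trans (normr_ge0 ((0 *: f : C01 R) point)))// maxnorm_ub.
have := le a^-1 (a *: f); rewrite scalerA mulVf// scale1r normfV.
by rewrite ler_pdivlMl ?normr_gt0.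
Qed.

Let maxnorm0_eq0 (f : C01 R) : maxnorm f = 0 -> f = 0.
Proof.
move=> f0; apply/val_inj/funext => x /=; apply/eqP.
by rewrite -normr_le0 -f0 maxnorm_ub.
Qed.

HB.instance Definition _ :=
  Lmodule_isNormed.Build R (C01 R) maxnormD maxnormZ maxnorm0_eq0.

Lemma C01_normE (f : C01 R) : `|f| = maxnorm f. Proof. by []. Qed.

End C01.

Definition C01_nonneg (R : realType) : set (C01 R) :=
  [set f | forall s, 0 <= f s].
Arguments C01_nonneg : clear implicits.

Notation borelI01 R := (g_sigma_algebraType (@open (I01 R))).

(* Regularity in the sense of Dunford and Schwartz: every E in the sigma-field
   is squeezed between a closed F and an open G such that m is smaller than e
   on every measurable part of G `\` F. *)
Definition regular_setfun (R : realType) (m : set (borelI01 R) -> R) :=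
  forall (E : set (borelI01 R)) (e : R), measurable E -> 0 < e ->
  exists F G : set (I01 R), [/\ closed F, open G, F `<=` E, E `<=` G &
    forall C : set (borelI01 R), measurable C -> C `<=` G `\` F -> `|m C| < e].

(* Set functions are total on subsets of [0, 1]. Requiring the value 0 on the
   sets that are not Borel makes Leibniz equality the equality of measures on
   the Borel sigma-field, so that the total variation is a norm and not only a
   semi-norm. *)
Definition rca_set (R : realType) : set (set (borelI01 R) -> R) :=
  [set m | [/\ forall A : set (borelI01 R), ~ measurable A -> m A = 0,
               m set0 = 0,
               semi_sigma_additive (EFin \o m) &
               regular_setfun m]].
Arguments rca_set : clear implicits.

Definition rca_pred (R : realType) : {pred set (borelI01 R) -> R} :=
  mem (rca_set R).
Arguments rca_pred : clear implicits.

Record rca (R : realType) := MkRca {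
  rca_fun :> set (borelI01 R) -> R ;
  rca_ax : rca_fun \in rca_pred R }.

Section rca.
Variable R : realType.
Local Notation T := (borelI01 R).

HB.instance Definition _ := [isSub for @rca_fun R].
HB.instance Definition _ := [Choice of rca R by <:].

Let rca_submod_closed : submod_closed (rca_pred R).
Proof.
rewrite /rca_pred; split=> [|a m n]; rewrite ?inE.
  split=> //.
    move=> F _ _ _; rewrite (_ : (fun _ => _) = cst 0%E); first exact: cvg_cst.
    by apply/funext => k; rewrite big1.
  move=> E e mE e0; exists set0, setT; split=> //.
  - exact: closed0.
  - exact: openT.
  - by move=> C _ _; rewrite normr0.
move=> [m_out m0 m_add m_reg] [n_out n0 n_add n_reg].
have mnE A : (a *: m + n) A = a * m A + n A by [].
split.
- by move=> A mA; rewrite mnE (m_out A mA) (n_out A mA) mulr0 addr0.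
- by rewrite mnE m0 n0 mulr0 addr0.
- move=> F mF tF mUF.
  rewrite (_ : (fun _ => _) = (fun k => a%:E * (\sum_(0 <= i < k) (EFin \o m) (F i))
      + \sum_(0 <= i < k) (EFin \o n) (F i))%E); last first.
    apply/funext => k; rewrite /= !sumEFin -EFinM -EFinD mulr_sumr -big_split.
    by [].
  rewrite [X in _ --> X](_ : _ = (a%:E * (m (\bigcup_k F k))%:E
    + (n (\bigcup_k F k))%:E)%E)//.
  apply: cvgeD => //; last exact: n_add.
  by apply: cvgeZl => //; exact: m_add.
- move=> E e mE e0.
  have d0 : 0 < `|a| + 1 by rewrite ltr_wpDl.
  have [F1 [G1 [cF1 oG1 F1E EG1 H1]]] := m_reg E _ mE (divr_gt0 (divr_gt0 e0 d0) (ltr0Sn R 1)).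
  have [F2 [G2 [cF2 oG2 F2E EG2 H2]]] := n_reg E _ mE (divr_gt0 e0 (ltr0Sn R 1)).
  exists (F1 `|` F2), (G1 `&` G2); split.
  + exact: closedU.
  + exact: openI.
  + by move=> x [/F1E|/F2E].
  + by move=> x Ex; split; [exact: EG1|exact: EG2].
  + move=> C mC CGF; rewrite mnE.
    rewrite (le_lt_trans (ler_normD _ _))// (splitr e) ler_ltD//; last first.
      by apply: H2 => // x /CGF[[_ ?] /not_orP[_ ?]].
    have mC1 : `|m C| < e / (`|a| + 1) / 2.
      by apply: H1 => // x /CGF[[? _] /not_orP[? _]].
    rewrite normrM (le_trans (ler_wpM2l (normr_ge0 a) (ltW mC1)))//.
    rewrite mulrA ler_wpM2r// mulrCA ler_piMr//; first exact: ltW.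
    by rewrite ler_pdivrMr// mul1r lerDl.
Qed.

HB.instance Definition _ := GRing.isSubmodClosed.Build R (set T -> R)
  (rca_pred R) rca_submod_closed.
HB.instance Definition _ := [SubChoice_isSubLmodule of rca R by <:].

Lemma rcaP (m : rca R) : rca_set R m.
Proof. by have := rca_ax m; rewrite /rca_pred inE. Qed.

Definition rca_charge (m : rca R) : set T -> \bar R := EFin \o m.

Let rca_charge0 (m : rca R) : rca_charge m set0 = 0%E.
Proof. by case: (rcaP m) => _ m0 _ _; rewrite /rca_charge/= m0. Qed.

Let rca_charge_fin (m : rca R) (A : set T) :
  measurable A -> rca_charge m A \is a fin_num.
Proof. by []. Qed.

Let rca_charge_sigma_additive (m : rca R) : semi_sigma_additive (rca_charge m).
Proof. by case: (rcaP m). Qed.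

HB.instance Definition _ (m : rca R) := isCharge.Build _ T R (rca_charge m)
  (rca_charge0 m) (@rca_charge_fin m) (@rca_charge_sigma_additive m).

(* A chosen Hahn decomposition; the measures [rca_pos] and [rca_neg] of the
   Jordan decomposition do not depend on this choice. *)
Lemma rca_hahn (m : rca R) :
  {PN : set T * set T | hahn_decomposition (rca_charge m) PN.1 PN.2}.
Proof.
by apply: cid; have [P [N PN]] := Hahn_decomposition (rca_charge m); exists (P, N).
Qed.

Definition rca_pos (m : rca R) : {finite_measure set T -> \bar R} :=
  jordan_pos (svalP (rca_hahn m)).

Definition rca_neg (m : rca R) : {finite_measure set T -> \bar R} :=
  jordan_neg (svalP (rca_hahn m)).

(* v(m, [0, 1]) *)
Definition tvnorm (m : rca R) : R :=
  fine (charge_variation (svalP (rca_hahn m)) setT).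

Lemma rca_chargeE (m : rca R) (A : set T) : measurable A ->
  rca_charge m A = (rca_pos m A - rca_neg m A)%E.
Proof.
move=> mA; rewrite (jordan_decomp (svalP (rca_hahn m)) mA) /cadd/=.
by rewrite cscaleN1.
Qed.

Lemma tvnormE (m : rca R) :
  (tvnorm m)%:E = (rca_pos m setT + rca_neg m setT)%E.
Proof. by rewrite fineK// /charge_variation fin_numD !fin_num_measure. Qed.

Lemma rca_hahnE (m : rca R) :
  exists P N : set T, [/\ measurable P, measurable N, P `|` N = setT,
    P `&` N = set0 & tvnorm m = m P - m N].
Proof.
case E : (rca_hahn m) => [[P N] PN]; have [[mP _] [mN _] PNT PN0] := PN.
exists P, N; split => //; rewrite /tvnorm E /charge_variation /=.
rewrite jordan_posE jordan_negE cjordan_posE cjordan_negE /crestr0.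
by rewrite !mem_set//= /crestr !setTI/=.
Qed.

Lemma tvnorm_ge (m : rca R) (P N : set T) : measurable P -> measurable N ->
  P `|` N = setT -> P `&` N = set0 -> `|m P| + `|m N| <= tvnorm m.
Proof.
move=> mP mN PNT PN0; rewrite -lee_fin EFinD.
apply: (@le_trans _ _ (charge_variation (svalP (rca_hahn m)) P
   + charge_variation (svalP (rca_hahn m)) N)%E).
  by apply: leeD; [exact: (abse_charge_variation (svalP (rca_hahn m)) mP)
    |exact: (abse_charge_variation (svalP (rca_hahn m)) mN)].
rewrite -measureU// PNT /tvnorm fineK//.
by rewrite /charge_variation fin_numD !fin_num_measure.
Qed.

Lemma tvnorm_ge0 (m : rca R) : 0 <= tvnorm m.
Proof. by apply: fine_ge0; rewrite /charge_variation adde_ge0. Qed.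

Let tvnormD (m n : rca R) : tvnorm (m + n) <= tvnorm m + tvnorm n.
Proof.
have [P [N [mP mN PNT PN0 ->]]] := rca_hahnE (m + n).
have := lerD (tvnorm_ge m mP mN PNT PN0) (tvnorm_ge n mP mN PNT PN0).
apply: le_trans; rewrite [(m + n)%R P]/(m P + n P) [(m + n)%R N]/(m N + n N).
rewrite opprD addrACA; apply: lerD; apply: lerD => //; rewrite ?ler_norm//.
- by rewrite -normrN ler_norm.
- by rewrite -normrN ler_norm.
Qed.

Let tvnormZ (a : R) (m : rca R) : tvnorm (a *: m) = `|a| * tvnorm m.
Proof.
have le b n : tvnorm (b *: n) <= `|b| * tvnorm n.
  have [P [N [mP mN PNT PN0 ->]]] := rca_hahnE (b *: n).
  have := ler_wpM2l (normr_ge0 b) (tvnorm_ge n mP mN PNT PN0).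
  apply: le_trans; rewrite [(b *: n)%R P]/(b * n P) [(b *: n)%R N]/(b * n N).
  rewrite mulrDr -!normrM lerD// ?ler_norm//.
  by rewrite -normrN ler_norm.
apply/eqP; rewrite eq_le le/=; have [->|a0] := eqVneq a 0.
  by rewrite normr0 mul0r tvnorm_ge0.
have := le a^-1 (a *: m); rewrite scalerA mulVf// scale1r normfV.
by rewrite ler_pdivlMl ?normr_gt0.
Qed.

Let tvnorm0_eq0 (m : rca R) : tvnorm m = 0 -> m = 0.
Proof.
move=> m0; apply/val_inj/funext => A /=; apply/eqP.
have [mA|mA] := pselect (measurable A); last first.
  by have [m_out _ _ _] := rcaP m; rewrite m_out.
rewrite -normr_le0 -m0.
have := @tvnorm_ge m A (~` A) mA (measurableC mA) (setUv _) (setICr _).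
by apply: le_trans; rewrite lerDl.
Qed.

HB.instance Definition _ :=
  Lmodule_isNormed.Build R (rca R) tvnormD tvnormZ tvnorm0_eq0.

Lemma rca_normE (m : rca R) : `|m| = tvnorm m. Proof. by []. Qed.

End rca.

(* The integral of f with respect to the signed measure m. *)
Definition pairing (R : realType) (m : rca R) (f : C01 R) : R :=
  Rintegral (rca_pos m) setT (f : borelI01 R -> R) -
  Rintegral (rca_neg m) setT (f : borelI01 R -> R).

Section pairing.
Variable R : realType.
Local Notation T := (borelI01 R).
Implicit Types (f : C01 R) (m n : rca R).

Lemma C01_measurable f : measurable_fun [set: T] (f : T -> R).
Proof.
apply: (measurability _ (RGenOInfty.measurableE R)) => // _ [_ [a ->] <-].
rewrite setTI; apply: sub_sigma_algebra.
apply: open_comp; last exact: interval_open.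
by move=> x _; exact: C01_continuous.
Qed.

Lemma C01_integrable f (mu : {measure set T -> \bar R}) : fin_num_fun mu ->
  mu.-integrable [set: T] (EFin \o (f : T -> R)).
Proof.
move=> mufin; apply: measurable_bounded_integrable => //.
- by rewrite ltey_eq mufin.
- exact: C01_measurable.
- exists (maxnorm f); split; first exact: num_real.
  by move=> M fM x _; rewrite /= (le_trans (maxnorm_ub f x))// ltW.
Qed.

Let measure_add_fin (m1 m2 : {finite_measure set T -> \bar R}) :
  fin_num_fun (measure_add m1 m2).
Proof.
move=> A mA; rewrite [measure_add _ _ _]measure_addE fin_numD.
by rewrite !fin_num_measure.
Qed.

Let mscale_fin (k : {nonneg R}) (m1 : {finite_measure set T -> \bar R}) :
  fin_num_fun (mscale k m1).
Proof. by move=> A mA; rewrite /mscale fin_numM// fin_num_measure. Qed.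

Let measure_addRE f (m1 m2 : {measure set T -> \bar R}) :
  fin_num_fun m1 -> fin_num_fun m2 ->
  Rintegral (measure_add m1 m2) setT (f : T -> R) =
  Rintegral m1 setT (f : T -> R) + Rintegral m2 setT (f : T -> R).
Proof.
move=> /(C01_integrable f) i1 /(C01_integrable f) i2.
rewrite /Rintegral (integral_measure_add measurableT i1 i2).
by rewrite fineD//; exact: integrable_fin_num.
Qed.

Let mscaleRE f (k : {nonneg R}) (m1 : {measure set T -> \bar R}) :
  fin_num_fun m1 ->
  Rintegral (mscale k m1) setT (f : T -> R) =
  k%:num * Rintegral m1 setT (f : T -> R).
Proof.
move=> /(C01_integrable f) intf.
have mf : measurable_fun [set: T] (EFin \o (f : T -> R)).
  by apply/measurable_EFinP; exact: C01_measurable.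
rewrite /Rintegral integralE [in RHS]integralE.
rewrite !ge0_integral_mscale//;
  [|exact: measurable_funeneg|exact: measurable_funepos].
have fp := integrable_pos_fin_num measurableT intf.
have fn := integrable_neg_fin_num measurableT intf.
rewrite fineB ?fin_numM// fineB//.
by rewrite !fineM// mulrBr.
Qed.

Let sube_eq_adde (p n r1 r2 : \bar R) : p \is a fin_num -> n \is a fin_num ->
  r1 \is a fin_num -> r2 \is a fin_num ->
  (p - n = r1 - r2)%E -> (r1 + n = p + r2)%E.
Proof.
case: p n r1 r2 => [p||]// [n||]// [r1||]// [r2||]// _ _ _ _ e.
have {}e : p - n = r1 - r2 by exact: EFin_inj e.
rewrite -!EFinD; congr EFin.
by apply/eqP; rewrite -subr_eq addrAC -e subrK.
Qed.

Let muleB_opp (a : R) (p n : \bar R) : p \is a fin_num -> n \is a fin_num ->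
  (a%:E * (p - n) = (- a)%:E * n - (- a)%:E * p)%E.
Proof.
case: p n => [p||]// [n||]// _ _.
by rewrite -!(EFinM, EFinB, EFinN, EFinD) mulrBr !mulNr opprK addrC.
Qed.

(* Any decomposition of m as a difference of finite measures computes the
   integral. *)
Lemma pairingE m f (m1 m2 : {measure set T -> \bar R}) :
  fin_num_fun m1 -> fin_num_fun m2 ->
  (forall A, measurable A -> rca_charge m A = (m1 A - m2 A)%E) ->
  pairing m f = Rintegral m1 setT (f : T -> R) - Rintegral m2 setT (f : T -> R).
Proof.
have pfin : fin_num_fun (rca_pos m) by exact: fin_num_measure.
have nfin : fin_num_fun (rca_neg m) by exact: fin_num_measure.
move=> fin1 fin2 m12; apply/eqP; rewrite /pairing subr_eq addrAC eq_sym subr_eq; apply/eqP.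
rewrite -!measure_addRE//; congr fine; apply: eq_measure_integral => A mA _.
rewrite [LHS]measure_addE [RHS]measure_addE.
by apply: sube_eq_adde; rewrite ?pfin ?nfin ?fin1 ?fin2// -rca_chargeE// m12.
Qed.

Lemma pairingDl m n f : pairing (m + n) f = pairing m f + pairing n f.
Proof.
rewrite (@pairingE _ _ (measure_add (rca_pos m) (rca_pos n))
  (measure_add (rca_neg m) (rca_neg n)) (@measure_add_fin _ _)
  (@measure_add_fin _ _)) => [|A mA].
  rewrite !measure_addRE; try exact: fin_num_measure.
  by rewrite /pairing opprD addrACA.
rewrite [X in (X - _)%E]measure_addE [X in (_ - X)%E]measure_addE.
rewrite (_ : rca_charge _ A = rca_charge m A + rca_charge n A)%E//.
by rewrite !rca_chargeE// fin_num_oppeD ?fin_num_measure// addeACA.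
Qed.

Lemma pairingZl a m f : pairing (a *: m) f = a * pairing m f.
Proof.
have aE A : rca_charge (a *: m) A = (a%:E * rca_charge m A)%E by [].
have [a0|a0] := leP 0 a.
  rewrite (@pairingE _ _ (mscale (NngNum a0) (rca_pos m))
    (mscale (NngNum a0) (rca_neg m)) (@mscale_fin _ _) (@mscale_fin _ _)).
    by rewrite !mscaleRE -?mulrBr//; exact: fin_num_measure.
  move=> A mA; rewrite aE rca_chargeE// muleBr// fin_num_adde_defr//.
  by rewrite fin_num_measure.
have na0 : 0 <= - a by rewrite oppr_ge0 ltW.
rewrite (@pairingE _ _ (mscale (NngNum na0) (rca_neg m))
  (mscale (NngNum na0) (rca_pos m)) (@mscale_fin _ _) (@mscale_fin _ _)).
  rewrite !mscaleRE; try exact: fin_num_measure.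
  by rewrite -mulrBr/= mulNr -mulrN opprB.
move=> A mA; rewrite aE rca_chargeE// /mscale/=.
by apply: muleB_opp; exact: fin_num_measure.
Qed.

Lemma pairing_bound m f : `|pairing m f| <= `|f| * `|m|.
Proof.
have le (mu : {finite_measure set T -> \bar R}) :
    (`|Rintegral mu setT (f : T -> R)|%:E <= `|f|%:E * mu setT)%E.
  have intf := C01_integrable f (@fin_num_measure _ _ _ mu).
  rewrite EFin_normr_Rintegral//.
  have mf : measurable_fun [set: T] (EFin \o (f : T -> R)).
    by apply/measurable_EFinP; exact: C01_measurable.
  rewrite (le_trans (le_abse_integral mu measurableT mf))//.
  apply: integral_le_bound => //.
  by apply: aeW => x _; rewrite lee_fin maxnorm_ub.
rewrite -lee_fin EFinM tvnormE ge0_muleDr// (le_trans _ (leeD (le _) (le _)))//.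
by rewrite -EFinD lee_fin ler_normB.
Qed.

End pairing.

Record dual_space (R : realType) (V : normedModType R) := MkDual {
  dual_fun :> {linear V -> R^o};
  dual_cts : continuous dual_fun }.

Section bidual.
Variable R : realType.
Implicit Types f : C01 R.

Definition eval_at f : rca R -> R^o := fun m => pairing m f.

Let eval_at_linear f : linear (eval_at f).
Proof. by move=> a m n; rewrite /eval_at pairingDl pairingZl. Qed.

HB.instance Definition _ f :=
  GRing.isLinear.Build R (rca R) R^o *:%R (eval_at f) (eval_at_linear f).

Lemma eval_at_continuous f : continuous (eval_at f).
Proof.
apply: bounded_linear_continuous; apply/bounded_funP => r.
exists (`|f| * r) => m mr.
by rewrite (le_trans (pairing_bound _ _))// ler_wpM2l.
Qed.

(* f^** *)
Definition bidual_embed f : dual_space (rca R) := MkDual (@eval_at_continuous f).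

End bidual.

Definition duality_map (R : realType) (f : C01 R) : set (rca R) :=
  [set m | pairing m f = `|f| ^+ 2 /\ `|f| ^+ 2 = `|m| ^+ 2].

Definition mordukhovich_quotient (R : realType) (f : C01 R) (m : rca R)
    (Phi : dual_space (rca R)) (l : rca R) (p : C01 R * rca R) : R :=
  (pairing l (p.1 - f) - Phi (p.2 - m)) / (`|p.1 - f| + `|p.2 - m|).

(* (g, gamma) tends to (f, m) in the product of the two norm topologies, along
   the graph of the duality mapping and with (g, gamma) <> (f, m). *)
Definition mordukhovich_derivative (R : realType) (f : C01 R) (m : rca R)
    (Phi : dual_space (rca R)) : set (rca R) :=
  [set l | (limf_esup (fun p => (mordukhovich_quotient f m Phi l p)%:E)
    (within [set p | duality_map p.1 p.2] (f, m)^') <= 0)%E].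

(* Main.v *)
Require Import Defs.
From HB Require Import structures.
From mathcomp Require Import all_boot all_order all_algebra.
From mathcomp Require Import all_classical all_reals all_analysis.
From mathcomp Require Import ring.
Import Order.TTheory GRing.Theory Num.Theory.
Import numFieldNormedType.Exports.
Local Open Scope classical_set_scope.
Local Open Scope ring_scope.

(** The duality mapping is homogeneous: if [mu] lies in [J f], then
    [(1 + t) *: mu] lies in [J ((1 + t) *: f)] for every real [t], so the graph
    of [J] contains the whole line through [(f, mu)] in the direction
    [(f, mu)].  On this line the numerator of the quotient defining the
    Mordukhovich derivative at [f^**], tested against [c *: mu], is
    [t * (c - 1) * `|f| ^+ 2], because [f^**] and [f] pair with [mu] to the same
    number, while the denominator is [`|t| * (2 * `|f|)].  Approaching
    [(f, mu)] with [t] of the sign of [c - 1] therefore keeps the quotient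
    constantly equal to [`|c - 1| * `|f| / 2], which is positive
    ([quotient_radial]), and an upper limit is at least the value along any
    particular approach ([limf_esup_ge_along]). *)

(** An upper limit dominates every lower bound that holds along one map [phi]
    tending to [F], since each member of [F] contains values of [phi]. *)
Lemma limf_esup_ge_along {S T : choiceType} {X : filteredType T}
    {R : realType} (h : X -> \bar R) (F : set_system X)
    (G : set_system S) (FG : ProperFilter G) (phi : S -> X) (a : \bar R) :
  phi @ G `=>` F -> (\forall s \near G, (a <= h (phi s))%E) ->
  (a <= limf_esup h F)%E.
Proof.
move=> phiF a_le; rewrite limf_esupE; apply: le_ereal_inf_tmp => _ [V FV <-].
have [s [Vs as_]] := filter_ex (filterI (phiF V FV : G (phi @^-1` V)) a_le).
by apply: (le_trans as_); apply: ereal_sup_ubound; exists (phi s).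
Qed.

Lemma pairingZr (R : realType) (m : rca R) (a : R) (f : C01 R) :
  pairing m (a *: f) = a * pairing m f.
Proof.
have scale (nu : {finite_measure set (borelI01 R) -> \bar R}) :
    Rintegral nu setT ((a *: f : C01 R) : borelI01 R -> R) =
    a * Rintegral nu setT (f : borelI01 R -> R).
  rewrite -RintegralZl//.
  exact: (C01_integrable f (@fin_num_measure _ _ _ nu)).
by rewrite /pairing !scale mulrBr.
Qed.

Lemma duality_mapZ {R : realType} {f : C01 R} {m : rca R} (a : R) :
  duality_map f m -> duality_map (a *: f) (a *: m).
Proof.
move=> [mf fm]; split; last by rewrite !normrZ !exprMn fm.
by rewrite pairingZl pairingZr mf normrZ exprMn real_normK ?num_real//; ring.
Qed.

Lemma duality_map_norm {R : realType} {f : C01 R} {m : rca R} :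
  duality_map f m -> `|m| = `|f|.
Proof. by move=> [_ /eqP]; rewrite eqrXn2// => /eqP. Qed.

(** Radial steps are [(c - 1) * s] with [s > 0] so that both [c < 1] and
    [c > 1] yield the same positive value. *)
Lemma quotient_radial (R : realType) (f : C01 R) (m : rca R) (c s : R) :
  0 < `|f| -> duality_map f m -> c != 1 -> 0 < s ->
  mordukhovich_quotient f m (bidual_embed f) (c *: m)
    ((1 + (c - 1) * s) *: f, (1 + (c - 1) * s) *: m) = `|c - 1| * `|f| / 2.
Proof.
move=> f0 Jm c1 s0; have nm := duality_map_norm Jm; have [mf _] := Jm.
rewrite /mordukhovich_quotient /= !scalerDl !scale1r ![_ + _ *: _]addrC !addrK.
rewrite /eval_at pairingZl pairingZr pairingZl mf !normrZ (gtr0_norm s0) nm.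
have c10 : 0 < `|c - 1| by rewrite normr_gt0 subr_eq0.
have sq : (c - 1) ^+ 2 = `|c - 1| ^+ 2 by rewrite real_normK ?num_real.
transitivity ((c - 1) ^+ 2 * (s * `|f| ^+ 2) / (`|c - 1| * s * `|f| *+ 2)).
  by congr (_ / _); ring.
by rewrite sq; field; rewrite !gt_eqF.
Qed.

Lemma cvg_radial (R : realType) (V : normedModType R) (v : V) (b : R) :
  (1 + b * s) *: v @[s --> 0^'+] --> v.
Proof.
have -> : nbhs v = nbhs ((1 + b * 0) *: v) by rewrite mulr0 addr0 scale1r.
apply: cvg_at_right_filter; apply: cvgZr_tmp; apply: cvgD; first exact: cvg_cst.
by apply: cvgM; [exact: cvg_cst|exact: cvg_id].
Qed.

Theorem theorem5p8 (R : realType) (f : C01 R) (f_nonneg : f \in C01_nonneg R)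
    (f_gt0 : 0 < `|f|) (mu : rca R) (mu_J : mu \in duality_map f)
    (c : R) (c_gt0 : 0 < c) (c_neq1 : c <> 1) :
  ~ (c *: mu \in mordukhovich_derivative f mu (bidual_embed f)).
Proof.
move: mu_J => /set_mem muJ /set_mem; rewrite /mordukhovich_derivative /=.
have c1 : c != 1 by exact/eqP.
have f_neq0 : f != 0 by rewrite -normr_gt0.
apply/negP; rewrite -ltNge.
apply: (@lt_le_trans _ _ (`|c - 1| * `|f| / 2)%:E).
  by rewrite lte_fin divr_gt0// mulr_gt0// normr_gt0 subr_eq0.
pose radial (s : R) := ((1 + (c - 1) * s) *: f, (1 + (c - 1) * s) *: mu).
apply: (@limf_esup_ge_along _ _ (C01 R * rca R)%type _ _ _ (0 : R)^'+ _ radial).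
- have radial_cvg : radial s @[s --> 0^'+] --> (f, mu).
    exact: cvg_pair (@cvg_radial R (C01 R) f (c - 1)) (@cvg_radial R (rca R) mu (c - 1)).
  move=> V /radial_cvg; apply: filterS2 (nbhs_right_gt 0) => s s0 /=.
  apply; last exact: duality_mapZ.
  apply/eqP => -[/eqP + _].
  rewrite -subr_eq0 scalerDl scale1r addrAC subrr add0r scaler_eq0.
  by rewrite (negbTE f_neq0) orbF mulf_eq0 subr_eq0 (negbTE c1) gt_eqF.
- by near=> s; rewrite quotient_radial.
Unshelve. all: by end_near. Qed.
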